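(* Let $q$ be a prime power, let $\mathrm{Q}=\mathrm{Q}^+(5,q)$ be a non-singular hyperbolic quadric of $\mathrm{PG}(5,q)$, let $\mathrm{Q}'$ be a quadric of $\mathrm{PG}(5,q)$ distinct from $\mathrm{Q}$, and let $V=\mathrm{Q}\cap\mathrm{Q}'$. If $|V|>q^3+5q^2+1$, then the intersection $\mathrm{Q}^+(5,q)\cap\mathrm{Q}'$ is equal to the intersection of $\mathrm{Q}^+(5,q)$ with the union of two hyperplanes of $\mathrm{PG}(5,q)$.
   Context: $\mathrm{PG}(5,q)$ is the $5$-dimensional projective space over $\mathbb{F}_q$. A quadric is given by a nonzero homogeneous quadratic polynomial over $\mathbb{F}_q$, up to nonzero scalar, and is identified with its set of $\mathbb{F}_q$-rational points when taking intersections and cardinalities; two quadrics are distinct if their polynomials are not proportional. The non-singular hyperbolic quadric $\mathrm{Q}^+(5,q)$ has, up to projective equivalence, equation $X_0X_1+X_2X_3+X_4X_5=0$. The two hyperplanes are distinct. *)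

(* Defs.v *)
From HB Require Import structures.
From mathcomp Require Import all_boot all_order all_algebra.
From mathcomp Require Import mpoly.

Set Implicit Arguments.
Unset Strict Implicit.
Unset Printing Implicit Defensive.

Import GRing.Theory.
Local Open Scope ring_scope.

Definition proj_point (F : finFieldType) (n : nat) (v : 'rV[F]_n.+1) :
  {set 'rV[F]_n.+1} := [set a *: v | a : F].

(* PG(n, F), each point being the set of all vectors of a one-dimensional
   subspace of F^(n+1). *)
Definition PG (n : nat) (F : finFieldType) : {set {set 'rV[F]_n.+1}} :=
  [set proj_point v | v : 'rV[F]_n.+1 & v != 0].

(* The F-rational points at which p vanishes; intended for p homogeneous of
   positive degree, which vanishes at all vectors of a point as soon as it
   vanishes at a nonzero one. *)
Definition zeros (F : finFieldType) (n : nat) (p : {mpoly F[n.+1]}) :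
  {set {set 'rV[F]_n.+1}} :=
  [set x in PG n F | [forall v in x, p.@[v 0] == 0]].

Definition quadric (F : finFieldType) (n : nat) (p : {mpoly F[n.+1]}) : Prop :=
  p != 0 /\ p \is 2.-homog.

Definition proportional (F : finFieldType) (n : nat) (p r : {mpoly F[n]}) :
  Prop := exists2 c : F, c != 0 & r = c *: p.

Definition lin_subst (F : finFieldType) (n : nat) (A : 'M[F]_n)
  (p : {mpoly F[n]}) : {mpoly F[n]} :=
  p \mPo [tuple \sum_(j < n) A i j *: 'X_j | i < n].

Definition klein_form (F : finFieldType) : {mpoly F[6]} :=
  'X_(inord 0) * 'X_(inord 1) + 'X_(inord 2) * 'X_(inord 3)
  + 'X_(inord 4) * 'X_(inord 5).

(* p is an equation of a non-singular hyperbolic quadric of PG(5, F). *)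
Definition hyperbolic_quadric (F : finFieldType) (p : {mpoly F[6]}) : Prop :=
  exists2 A : 'M[F]_6, A \in unitmx &
    proportional (lin_subst A (klein_form F)) p.

Definition hyperplane (F : finFieldType) (n : nat)
  (H : {set {set 'rV[F]_n.+1}}) : Prop :=
  exists l : {mpoly F[n.+1]}, [/\ l != 0, l \is 1.-homog & H = zeros l].

(* Main.v *)
Require Import Defs.
From HB Require Import structures.
From mathcomp Require Import all_boot all_order all_algebra.
From mathcomp Require Import mpoly ring zify.

Set Implicit Arguments.
Unset Strict Implicit.
Unset Printing Implicit Defensive.

Import GRing.Theory.
Local Open Scope ring_scope.

(** Let f and g be the quadratic forms of [Q] and [Q'] on the vector space
    F^6.  A common zero of f and g is a zero of all q + 1 members of the pencil
    they span, namely f and the forms g - t f; any other vector is a zero of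
    exactly one member ([pencil_count]).  So the size of the intersection is
    determined by the numbers of zeros of the members of the pencil.

    Splitting off hyperbolic planes one at a time shows that a quadratic form
    on F^6 either has at most q^5 zeros, or is a sum of k products of two
    linear forms, where k is the number of planes, and has exactly
    q^5 + (q - 1) q^(5 - k) zeros ([witt_count]).  In the second case its polar
    form has rank at most 2 k ([rank_sum_products]).

    Suppose that some g - t f is such a sum with k < 2.  If k = 0, then g = t f
    as functions, hence as polynomials ([upper_quad0]), which is excluded.  If
    k = 1, then g - t f is the product of the two linear forms attached to a
    hyperbolic pair.  These have different kernels, and on the zeros of f the
    form g vanishes exactly on the union of the two kernels.

    Suppose that no g - t f is of this kind.  Then each of them has at most
    q^5 + (q - 1) q^3 zeros, and more than q^5 + (q - 1) q^2 only if k = 2, so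
    that its polar form has rank at most 4.  As the polar form S of f is
    invertible ([klein_nondegenerate]), a parameter t of that kind is an
    eigenvalue of T S^-1, with T the polar form of g, whose eigenspace has
    dimension at least 2; hence there are at most three of them
    ([pencil_rank]).  As f itself has at most q^5 + (q - 1) q^2 zeros, summing
    over the pencil gives at most q^3 + 5 q^2 - q + 1 common points
    ([pencil_bound]).

    The polar form stands in for the bilinear form of f, and no step divides by
    2, so the argument is the same in all characteristics. *)

(** * Quadratic forms given by square matrices *)

Definition bilin (F : fieldType) n (S : 'M[F]_n) (x y : 'rV[F]_n) : F :=
  (x *m S *m y^T) 0 0.

Definition quad (F : fieldType) n (M : 'M[F]_n) (x : 'rV[F]_n) : F :=
  bilin M x x.

Section Forms.
Variables (F : fieldType) (n : nat).
Implicit Types (M S : 'M[F]_n) (x y z : 'rV[F]_n).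

Lemma bilinDl S x y z : bilin S (x + y) z = bilin S x z + bilin S y z.
Proof. by rewrite /bilin !mulmxDl mxE. Qed.

Lemma bilinZl S a x z : bilin S (a *: x) z = a * bilin S x z.
Proof. by rewrite /bilin -!scalemxAl mxE. Qed.

Lemma bilinDr S x y z : bilin S x (y + z) = bilin S x y + bilin S x z.
Proof. by rewrite /bilin linearD mulmxDr mxE. Qed.

Lemma bilinZr S a x z : bilin S x (a *: z) = a * bilin S x z.
Proof. by rewrite /bilin linearZ -scalemxAr mxE. Qed.

Lemma bilin_tr S x y : bilin S^T x y = bilin S y x.
Proof.
rewrite /bilin -[in RHS](trmxK (y *m S *m x^T)) [in RHS]mxE.
by rewrite !trmx_mul trmxK mulmxA.
Qed.

Lemma bilinDm S T x y : bilin (S + T) x y = bilin S x y + bilin T x y.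
Proof. by rewrite /bilin mulmxDr mulmxDl mxE. Qed.

Lemma bilinZm a S x y : bilin (a *: S) x y = a * bilin S x y.
Proof. by rewrite /bilin -scalemxAr -scalemxAl mxE. Qed.

Lemma bilin_inj S T : (forall x y, bilin S x y = bilin T x y) -> S = T.
Proof.
move=> e; apply/matrixP=> i j; move: (e (delta_mx 0 i) (delta_mx 0 j)).
by rewrite /bilin -!rowE !trmx_delta -!colE !mxE.
Qed.

Definition polar M : 'M[F]_n := M + M^T.

Definition polar_sum M (s : seq ('rV[F]_n * 'rV[F]_n)) x : F :=
  \sum_(p <- s) bilin (polar M) x p.1 * bilin (polar M) x p.2.

Lemma polarC M x y : bilin (polar M) x y = bilin (polar M) y x.
Proof. by rewrite !bilinDm !bilin_tr addrC. Qed.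

Lemma quadD M x y : quad M (x + y) = quad M x + quad M y + bilin (polar M) x y.
Proof. by rewrite bilinDm bilin_tr /quad bilinDl !bilinDr; ring. Qed.

Lemma quadZ M a x : quad M (a *: x) = a ^+ 2 * quad M x.
Proof. by rewrite /quad bilinZl bilinZr mulrA expr2. Qed.

Lemma polar_diag M x : bilin (polar M) x x = quad M x *+ 2.
Proof. by rewrite bilinDm bilin_tr mulr2n. Qed.

End Forms.

(** * Counting zeros by splitting off hyperbolic planes *)

Section Count.
Variables (F : finFieldType) (n : nat) (M : 'M[F]_n).
Local Notation V := 'rV[F]_n.
Local Notation f := (quad M).
Local Notation b := (bilin (polar M)).
Local Notation q := #|F|.
Implicit Types (W : {set V}) (x y z v w : V).

Definition comb_closed W : Prop :=
  forall a x y, x \in W -> y \in W -> a *: x + y \in W.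

Definition hyperbolic_pair (p : V * V) : Prop :=
  [/\ f p.1 = 0, f p.2 = 0 & b p.1 p.2 = 1].

Definition nzeros W : nat := (\sum_(x in W) (f x == 0%R))%N.

Definition perp W (p : V * V) : {set V} :=
  [set x in W | (b x p.1 == 0) && (b x p.2 == 0)].

(** For a hyperbolic pair (u, w), each vector is uniquely c u + d w + z with z
    orthogonal to u and w, and f takes the value c d + f z there.  The
    coordinates are c = b x w and d = b x u, and z = [hproj x]. *)
Section Split.
Variables (p : V * V) (hp : hyperbolic_pair p).

Definition hproj x : V := x - (b x p.2 *: p.1 + b x p.1 *: p.2).

Lemma pair_values :
  [/\ b p.1 p.1 = 0, b p.1 p.2 = 1, b p.2 p.1 = 1 & b p.2 p.2 = 0].
Proof.
case: hp => h1 h2 h12.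
by split; rewrite ?polar_diag ?h1 ?h2 ?mul0rn // polarC.
Qed.

Lemma polar_comb z c d : b z p.1 = 0 -> b z p.2 = 0 ->
  b (c *: p.1 + d *: p.2 + z) p.1 = d /\ b (c *: p.1 + d *: p.2 + z) p.2 = c.
Proof.
move=> z1 z2; have [e11 e12 e21 e22] := pair_values.
by rewrite !bilinDl !bilinZl z1 z2 e11 e12 e21 e22; split; ring.
Qed.

Lemma quad_comb z c d : b z p.1 = 0 -> b z p.2 = 0 ->
  f (c *: p.1 + d *: p.2 + z) = c * d + f z.
Proof.
move=> z1 z2; have [e11 e12 e21 e22] := pair_values; have [h1 h2 _] := hp.
rewrite quadD bilinDl !bilinZl quadD !quadZ bilinZl bilinZr h1 h2 e12.
by rewrite (polarC M p.1) (polarC M p.2) z1 z2; ring.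
Qed.

Lemma hproj_perp x : b (hproj x) p.1 = 0 /\ b (hproj x) p.2 = 0.
Proof.
have [e11 e12 e21 e22] := pair_values.
rewrite /hproj -scaleN1r !bilinDl !bilinZl !bilinDl !bilinZl e11 e12 e21 e22.
by split; ring.
Qed.

Lemma hprojK x : b x p.2 *: p.1 + b x p.1 *: p.2 + hproj x = x.
Proof. by rewrite addrC subrK. Qed.

Lemma quad_split x : f x = b x p.1 * b x p.2 + f (hproj x).
Proof.
have [? ?] := hproj_perp x.
by rewrite -[in LHS](hprojK x) quad_comb // mulrC.
Qed.

Lemma hproj_comb z c d : b z p.1 = 0 -> b z p.2 = 0 ->
  hproj (c *: p.1 + d *: p.2 + z) = z.
Proof.
move=> z1 z2; rewrite /hproj; have [-> ->] := polar_comb c d z1 z2.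
by rewrite addrC addKr.
Qed.

Variable W : {set V}.
Hypothesis Wlin : comb_closed W.
Hypotheses (W1 : p.1 \in W) (W2 : p.2 \in W).

Lemma hproj_in x : x \in W -> hproj x \in perp W p.
Proof.
move=> Wx; have [e1 e2] := hproj_perp x.
rewrite inE e1 e2 eqxx !andbT /hproj opprD addrA -!scaleNr.
by rewrite addrC Wlin // addrC Wlin.
Qed.

Lemma comb_in z c d : z \in W -> c *: p.1 + d *: p.2 + z \in W.
Proof. by move=> Wz; rewrite -addrA !Wlin. Qed.

Lemma sum_split (G : V -> nat) :
  (\sum_(x in W) G x =
   \sum_(z in perp W p) \sum_c \sum_d G (c *: p.1 + d *: p.2 + z)%R)%N.
Proof.
rewrite (partition_big hproj (mem (perp W p))) => [|x /hproj_in //] /=.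
apply: eq_bigr => z; rewrite inE => /and3P[Wz /eqP z1 /eqP z2].
rewrite pair_big /=.
rewrite (reindex_onto (fun cd : F * F => cd.1 *: p.1 + cd.2 *: p.2 + z)
           (fun x => (b x p.2, b x p.1))) /=.
  apply: eq_bigl => -[c d] /=.
  have [-> ->] := polar_comb c d z1 z2.
  by rewrite hproj_comb // comb_in // !eqxx.
by move=> x /andP[_ /eqP <-]; exact: hprojK.
Qed.

Lemma card_split : #|W| = (q ^ 2 * #|perp W p|)%N.
Proof.
rewrite -sum1_card sum_split mulnC -sum_nat_const.
apply: eq_bigr => z _; under eq_bigr => c _ do rewrite sum1_card.
by rewrite sum_nat_const.
Qed.

Lemma sum_conic (e : F) :
  (\sum_(c : F) \sum_(d : F) (c * d + e == 0)%R = q.-1 + q * (e == 0)%R)%N.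
Proof.
rewrite (bigD1 0) //= addnC; congr addn.
  transitivity (\sum_(c : F | c != 0%R) 1)%N; last first.
    by rewrite sum1_card cardC1.
  apply: eq_bigr => c c0; rewrite (bigD1 (- e / c)) //= big1 => [|d].
    by rewrite mulrC divfK // addNr eqxx.
  apply: contraNeq; rewrite eqb0 negbK addr_eq0 => /eqP <-.
  by rewrite mulrC mulKf.
under eq_bigr => d _ do rewrite mul0r add0r.
by rewrite sum_nat_const.
Qed.

(** On the coset of the hyperbolic plane at z, the form is the conic equation
    c d + f z, so [sum_conic] counts its zeros. *)
Lemma nzeros_split :
  nzeros W = (q.-1 * #|perp W p| + q * nzeros (perp W p))%N.
Proof.
rewrite /nzeros sum_split big_distrr /= mulnC -sum_nat_const -big_split /=.
apply: eq_bigr => z; rewrite inE => /and3P[Wz /eqP z1 /eqP z2].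
rewrite -sum_conic; apply: eq_bigr => c _; apply: eq_bigr => d _.
by rewrite quad_comb.
Qed.

End Split.

Lemma nzerosE W : nzeros W = #|[set x in W | f x == 0]|.
Proof.
rewrite -sum1_card /nzeros [LHS]big_mkcond [RHS]big_mkcond /=.
by apply: eq_bigr => x _; rewrite inE; case: (x \in W) (f x == 0) => [] [].
Qed.

(** If every zero of f in W is orthogonal to W, then no nonzero multiple of w
    is the difference of two zeros, because f (a w + z) = a^2 f w for a zero z.
    So the translates of the set of zeros by the q multiples of w are disjoint
    subsets of W. *)
Lemma few_zeros W w :
    comb_closed W ->
    (forall x y, x \in W -> y \in W -> f x = 0 -> b x y = 0) ->
    w \in W -> f w != 0 ->
  (q * nzeros W <= #|W|)%N.
Proof.
move=> Wlin rad Ww fw; rewrite nzerosE.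
set Z := [set x in W | f x == 0].
have ZP z : z \in Z -> z \in W /\ f z = 0 by rewrite inE => /andP[? /eqP].
have -> : (q * #|Z|)%N = #|setX [set: F] Z| by rewrite cardsX cardsT.
have shift a z : z \in Z -> f (a *: w + z) = a ^+ 2 * f w.
  move=> /ZP[Wz fz]; rewrite quadD quadZ fz bilinZl polarC rad //; ring.
rewrite -(card_in_imset (f := fun az : F * V => az.1 *: w + az.2)).
  apply: subset_leq_card; apply/subsetP => _ /imsetP[[a z] + ->] /=.
  by rewrite inE /= => /andP[_ /ZP[Wz _]]; apply: Wlin.
move=> [a z] [a' z'] /=; rewrite !inE /= => Zz Zz' e.
have {}Zz : z \in Z by rewrite inE.
have {}Zz' : z' \in Z by rewrite inE.
suff ea : a = a' by move: e; rewrite ea => /addrI ->.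
have ez : z = (a' - a) *: w + z'.
  by rewrite scalerBl addrAC -e addrAC subrr add0r.
have := shift (a' - a) z' Zz'; rewrite -ez; have [_ ->] := ZP _ Zz.
move/esym/eqP; rewrite mulf_eq0 (negPf fw) orbF expf_eq0 /= subr_eq0.
by move/eqP.
Qed.

(** A second vector w with b x w = 1 can be moved along x until it is a zero:
    f (a x + w) = a + f w. *)
Lemma hyperbolic_pair_ex W x y :
    comb_closed W ->
    x \in W -> y \in W -> f x = 0 -> b x y != 0 ->
  exists p, [/\ hyperbolic_pair p, p.1 \in W & p.2 \in W].
Proof.
move=> Wlin Wx Wy fx bxy.
have W0 : 0 \in W by have := Wlin (-1) x x Wx Wx; rewrite scaleN1r addNr.
pose w := (b x y)^-1 *: y + 0.
have Ww : w \in W by apply: Wlin.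
have bw : b x w = 1 by rewrite /w addr0 bilinZr mulVf.
exists (x, (- f w) *: x + w); split; rewrite ?Wlin //; split=> //=.
  by rewrite quadD quadZ fx bilinZl bw; ring.
by rewrite bilinDr bilinZr polar_diag fx bw; ring.
Qed.

(** Hyperbolic planes are split off W until all zeros in the remaining space
    are orthogonal to it.  If f does not vanish on that space, the zeros fill
    at most a fraction 1 / q of it, and this bound passes up through
    [nzeros_split].  If f vanishes there, f is the sum of the products attached
    to the k pairs split off, and the fraction of zeros in W is
    1 / q + (q - 1) / q^(k + 1), which is the stated equation. *)
Lemma witt_count W :
    comb_closed W ->
  (q * nzeros W <= #|W|)%N \/
  exists s : seq (V * V),
    [/\ {in s, forall p, [/\ hyperbolic_pair p, p.1 \in W & p.2 \in W]},
        {in W, forall x, f x = polar_sum M s x}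
      & (q ^ (size s).+1 * nzeros W = #|W| * (q ^ size s + q.-1))%N].
Proof.
have [m] := ubnP #|W|; elim: m W => // m IHm W leW Wlin.
have [/existsP[x /andP[Wx /andP[/eqP fx /existsP[y /andP[Wy bxy]]]]]|rad] :=
    boolP [exists x in W, (f x == 0) && [exists y in W, b x y != 0]].
  have [p [hp W1 W2]] := hyperbolic_pair_ex Wlin Wx Wy fx bxy.
  have cW := card_split hp Wlin W1 W2.
  have nW := nzeros_split hp Wlin W1 W2.
  have q1 : (1 < q)%N := card_finNzRing_gt1 F.
  have Wp : (0 < #|perp W p|)%N.
    have : (0 < #|W|)%N by apply/card_gt0P; exists x.
    by rewrite cW muln_gt0 => /andP[].
  have Wplin : comb_closed (perp W p).
    move=> a z z'; rewrite !inE.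
    move=> /and3P[Wz /eqP z1 /eqP z2] /and3P[Wz' /eqP z1' /eqP z2'].
    by rewrite Wlin // !bilinDl !bilinZl z1 z2 z1' z2' !mulr0 !addr0 eqxx.
  have /IHm/(_ Wplin) : (#|perp W p| < m)%N by nia.
  case=> [few|[s [hs fs ns]]]; [left | right].
    rewrite nW cW expnS expn1 -mulnA leq_mul2l; apply/orP; right.
    by rewrite -[in leqRHS](prednK (ltnW q1)) mulSn addnC leq_add2r.
  exists (p :: s); split=> [r|z Wz|/=].
  - rewrite inE => /predU1P[->//|/hs[hr]].
    by rewrite !inE => /andP[r1 _] /andP[r2 _].
  - rewrite /polar_sum big_cons (quad_split hp) fs ?(hproj_in hp) //.
    congr (_ + _); apply: eq_big_seq => r /hs[_].
    (* The later pairs are orthogonal to the pair p, so z and its projection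
       have the same products with them. *)
    rewrite !inE => /and3P[_ /eqP r11 /eqP r12] /and3P[_ /eqP r21 /eqP r22].
    have hprojr u : b u p.1 = 0 -> b u p.2 = 0 -> b (hproj p z) u = b z u.
      move=> u1 u2; rewrite -[in RHS](hprojK p z) !bilinDl !bilinZl.
      by rewrite (polarC M p.1) (polarC M p.2) u1 u2 !mulr0 !add0r.
    by rewrite !hprojr.
  rewrite nW [#|W|]cW !expnS in ns *.
  set P := #|_| in ns *; set N := nzeros _ in ns *.
  set K := (q ^ size s)%N in ns *; rewrite !expn0 !muln1 in ns *.
  move: q (q.-1) (prednK (ltnW q1)) K P N ns => k r ek K P N ns.
  have -> : (k * (k * K) * (r * P + k * N) =
             k * (k * K) * (r * P) + k * k * (k * K * N))%N by ring.
  by rewrite ns -ek mulSn; ring.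
have [/existsP[w /andP[Ww fw]]|all0] := boolP [exists w in W, f w != 0].
  left; apply: few_zeros Ww fw => // x y Wx Wy fx.
  apply: contraNeq rad => bxy; apply/existsP; exists x.
  by rewrite Wx fx eqxx /=; apply/existsP; exists y; rewrite Wy.
right; exists [::]; have f0 x : x \in W -> f x = 0.
  move=> Wx; apply: contraNeq all0 => fx.
  by apply/existsP; exists x; rewrite Wx.
split=> // [x Wx|]; first by rewrite /polar_sum big_nil f0.
rewrite /= expn0 expn1 /nzeros (eq_bigr (fun=> 1%N)) => [|x /f0 ->]; last first.
  by rewrite eqxx.
have q0 : (0 < q)%N := ltnW (card_finNzRing_gt1 F).
by rewrite sum1_card mulnC; congr muln; exact: esym (prednK q0).
Qed.

End Count.

(** * Ranks of polar forms *)

(** Polarizing the product of the linear forms b(-, u) and b(-, w) gives the sum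
    of the two rank one forms b(-, u) b(-, w)' and b(-, w) b(-, u)', the prime
    marking the second variable. *)
Lemma rank_sum_products (F : fieldType) n (M : 'M[F]_n)
    (s : seq ('rV[F]_n * 'rV[F]_n)) :
  (forall x, quad M x = polar_sum M s x) -> (\rank (polar M) <= 2 * size s)%N.
Proof.
rewrite /polar_sum => fs; set S := polar M in fs *.
pose R (u v : 'rV[F]_n) : 'M_n := S *m u^T *m (v *m S).
have bilinR u v x y : bilin (R u v) x y = bilin S x u * bilin S v y.
  rewrite /bilin; have -> : x *m R u v *m y^T =
            (x *m S *m u^T) *m (v *m S *m y^T) by rewrite /R !mulmxA.
  by rewrite mxE big_ord1.
have -> : S = \sum_(p <- s) (R p.1 p.2 + R p.2 p.1).
  apply: bilin_inj => x y; have -> : bilin S x y =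
      quad M (x + y) - (quad M x + quad M y) by rewrite quadD addrC addKr.
  rewrite !fs [RHS]/bilin mulmx_sumr mulmx_suml summxE.
  rewrite -big_split -sumrN -big_split /=; apply: eq_bigr => p _.
  rewrite -[RHS]/(bilin _ x y) (bilinDm (R _ _)) !bilinR !bilinDl.
  by rewrite (polarC M p.1) (polarC M p.2) -/S; ring.
have rk1 u v : (\rank (R u v) <= 1)%N.
  by apply: leq_trans (mxrankM_maxl _ _) (rank_leq_col _).
elim: s {fs} => [|p s IHs] /=; first by rewrite big_nil mxrank0.
rewrite big_cons mulnS; apply: leq_trans (mxrank_add _ _) (leq_add _ IHs).
by apply: leq_trans (mxrank_add _ _) (leq_add (rk1 _ _) (rk1 _ _)).
Qed.

(** The rank of T - t S drops by the dimension of the eigenspace of T S^-1 at t,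
    and eigenspaces at distinct t are in direct sum. *)
Lemma pencil_rank (F : finFieldType) n (S T : 'M[F]_n) : S \in unitmx ->
  (2 * #|[set t | (\rank (T - t *: S)%R + 2 <= n)%N]| <= n)%N.
Proof.
move=> uS; set E := [set t | _].
pose A := T *m invmx S.
have rkA t : \rank (eigenspace A t) = (n - \rank (T - t *: S)%R)%N.
  rewrite mxrank_ker; congr subn.
  have -> : A - t%:M = (T - t *: S) *m invmx S.
    by rewrite mulmxBl -scalemxAl mulmxV // scalemx1.
  by rewrite mxrankMfree // row_free_unit unitmx_inv.
have /mxdirectP/= e :=
  @mxdirect_sum_eigenspace _ _ _ A (mem E) id (in2W (fun _ _ => id)).
have := rank_leq_col (\sum_(i in E) eigenspace A i)%MS.
rewrite e; apply: leq_trans; rewrite mulnC -sum_nat_const.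
apply: leq_sum => t; rewrite inE rkA => h.
by rewrite -(leq_add2l (\rank (T - t *: S))) subnKC // rank_leq_row.
Qed.

(** * Linear and quadratic polynomials *)

Section Polynomials.
Variables (F : finFieldType) (n : nat).
Implicit Types (M : 'M[F]_n) (a x : 'rV[F]_n).

Definition lform a : {mpoly F[n]} := \sum_j a 0 j *: 'X_j.
Definition qform M : {mpoly F[n]} := \sum_i \sum_j M i j *: ('X_i * 'X_j).

Lemma lform_eval a x : (lform a).@[x 0] = (x *m a^T) 0 0.
Proof.
rewrite /lform raddf_sum mxE; apply: eq_bigr => j _.
by rewrite /= mevalZ mevalXU mxE mulrC.
Qed.

Lemma lform_homog a : lform a \is 1.-homog.
Proof. by apply: rpred_sum => j _; apply: rpredZ; rewrite dhomogX /= mdeg1. Qed.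

Lemma qform_eval M x : (qform M).@[x 0] = quad M x.
Proof.
rewrite /qform /quad /bilin mxE exchange_big raddf_sum.
apply: eq_bigr => j _ /=.
rewrite raddf_sum mxE mulr_suml; apply: eq_bigr => i _ /=.
by rewrite mevalZ mevalM !mevalXU mxE mulrA (mulrC (M i j)).
Qed.

Lemma qformZD c M N : qform (c *: M + N) = c *: qform M + qform N.
Proof.
rewrite /qform scaler_sumr -big_split; apply: eq_bigr => i _ /=.
rewrite scaler_sumr -big_split; apply: eq_bigr => j _ /=.
by rewrite !mxE scalerDl scalerA.
Qed.

Lemma qform0 : qform 0 = 0.
Proof.
by have := qformZD (-1) 0 0; rewrite scaleN1r addr0 oppr0 scaleN1r addNr.
Qed.

Lemma qformZ c M : qform (c *: M) = c *: qform M.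
Proof. by have := qformZD c M 0; rewrite qform0 !addr0. Qed.

Lemma qform_delta i j : qform (delta_mx i j) = 'X_i * 'X_j.
Proof.
rewrite /qform (bigD1 i) //= (bigD1 j) //= !mxE !eqxx scale1r.
rewrite !big1 ?addr0 // => k nk; last by rewrite mxE eqxx (negPf nk) scale0r.
by rewrite big1 // => l _; rewrite mxE (negPf nk) scale0r.
Qed.

(** A quadratic polynomial comes from several matrices, which differ by
    alternating ones; upper triangular matrices are unique representatives. *)
Definition upper M := forall i j : 'I_n, (j < i)%N -> M i j = 0.

Lemma mdeg2 (m : 'X_{1..n}) : mdeg m = 2%N ->
  exists i j : 'I_n, (i <= j)%N /\ m = (U_(i) + U_(j))%MM.
Proof.
move=> m2; have [i mi] : exists i, m i != 0%N.
  case: (pickP (fun i => m i != 0%N)) => [i mi|m0]; first by exists i.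
  by move: m2; rewrite mdegE big1 // => i _; apply/eqP/negbFE/m0.
have mE : (m - U_(i) + U_(i))%MM = m by rewrite submK // lep1mP.
have /mdeg1P[j /eqP ej] : mdeg (m - U_(i))%MM == 1%N.
  by move: m2; rewrite -{1}mE mdegD mdeg1 addn1 => -[->].
rewrite ej in mE; have [ij|ji] := leqP i j.
  by exists i, j; split=> //; rewrite addmC.
by exists j, i; split=> //; exact: ltnW.
Qed.

Lemma homog2_qform (p : {mpoly F[n]}) : p \is 2.-homog ->
  exists2 M, upper M & p = qform M.
Proof.
move=> /dhomogP homp; rewrite (mpolyE p).
elim: (msupp p) homp => [|m s IHs] homp.
  exists 0 => [i j _|]; first by rewrite mxE.
  by rewrite big_nil qform0.
have [k ks|M uM eM] := IHs; first by apply: homp; rewrite inE ks orbT.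
have [i [j [ij em]]] := mdeg2 (homp m (mem_head _ _)).
exists (p@_m *: delta_mx i j + M); last first.
  by rewrite big_cons qformZD qform_delta -eM -mpolyXD -em.
move=> k l lk; rewrite !mxE uM // addr0.
by case: eqP lk => [->|]; case: eqP => [->|]; rewrite ?mulr0 // ltnNge ij.
Qed.

(** A quadratic form is determined by its values at the basis vectors e_i and at
    the sums e_i + e_j, even over the field with two elements. *)
Lemma upper_quad0 M : upper M -> (forall x, quad M x = 0) -> M = 0.
Proof.
move=> uM f0.
have diag i : M i i = 0.
  have := f0 (delta_mx 0 i).
  by rewrite /quad /bilin -rowE trmx_delta -colE !mxE.
have off i j : M i j + M j i = 0.
  have := quadD M (delta_mx 0 i) (delta_mx 0 j).
  by rewrite !f0 !addr0 add0r /bilin -rowE trmx_delta -colE !mxE => <-.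
apply/matrixP=> i j; rewrite mxE; case: (ltngtP i j) => [ij|ji|/val_inj <-//].
  by rewrite -(off i j) (uM j i) // addr0.
exact: uM.
Qed.

Lemma meval_scale (p : {mpoly F[n]}) d c x :
  p \is d.-homog -> p.@[(c *: x) 0] = c ^+ d * p.@[x 0].
Proof.
move=> /dhomogP homp; rewrite !mevalE mulr_sumr.
apply: eq_big_seq => m /homp dm; rewrite mulrCA; congr (_ * _).
under eq_bigr => i _ do rewrite mxE exprMn.
by rewrite big_split /= prodrXr -mdegE -dm.
Qed.

End Polynomials.

(** * Points of projective space *)

Section Points.
Variables (F : finFieldType) (n : nat).
Local Notation V := 'rV[F]_n.+1.

Lemma mem_zeros (p : {mpoly F[n.+1]}) d (v : V) : p \is d.-homog -> v != 0 ->
  (proj_point v \in zeros p) = (p.@[v 0] == 0).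
Proof.
move=> homp v0; rewrite inE /PG imset_f ?inE //=.
apply/forall_inP/eqP => [h|pv _ /imsetP[c _ ->]].
  by apply/eqP/h/imsetP; exists 1; rewrite ?scale1r.
by rewrite (meval_scale _ _ homp) pv mulr0.
Qed.

Lemma proj_pointZ c (v : V) : c != 0 -> proj_point (c *: v) = proj_point v.
Proof.
move=> c0; apply/setP=> x; apply/imsetP/imsetP=> -[a _ ->].
  by exists (a * c); rewrite ?scalerA.
by exists (a / c); rewrite ?scalerA ?divfK.
Qed.

(** Each projective point has at least q - 1 nonzero representatives. *)
Lemma card_points (X : {set {set V}}) : X \subset PG n F ->
  (#|F|.-1 * #|X| <= #|[set v : V | (v != 0)%R && (proj_point v \in X)]|)%N.
Proof.
move=> sX; rewrite -[leqRHS]sum1_card.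
rewrite (partition_big (@proj_point F n) (mem X)) => [|v]; last first.
  by rewrite inE => /andP[].
rewrite mulnC -sum_nat_const; apply: leq_sum => x Xx.
have /imsetP[v] := subsetP sX x Xx; rewrite inE => v0 ex.
rewrite sum1_card -(cardC1 0).
rewrite -(card_imset (f := fun c => c *: v)) => [|c d]; last first.
  move/eqP; rewrite -subr_eq0 -scalerBl scaler_eq0 (negPf v0) orbF subr_eq0.
  by move/eqP.
apply: subset_leq_card; apply/subsetP=> _ /imsetP[c c0 ->].
rewrite inE /= in c0; rewrite -topredE /= inE proj_pointZ // -ex eqxx Xx.
by rewrite scaler_eq0 negb_or c0 v0.
Qed.
(** The zero vector accounts for the summand 1. *)
Lemma card_common_zeros (M N : 'M[F]_n.+1) :
    qform M \is 2.-homog -> qform N \is 2.-homog ->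
  (#|F|.-1 * #|zeros (qform M) :&: zeros (qform N)| + 1 <=
   #|[set x | (quad M x == 0%R) && (quad N x == 0%R)]|)%N.
Proof.
move=> hM hN; set X := _ :&: _.
have sub : X \subset PG n F.
  by apply/subsetP => x; rewrite !inE => /andP[/andP[]].
have -> : [set x | (quad M x == 0%R) && (quad N x == 0%R)] =
    0 |: [set v : V | (v != 0) && (proj_point v \in X)].
  apply/setP=> v; rewrite inE in_setU1 inE; have [->|v0] /= := eqVneq v 0.
    by rewrite /quad /bilin !mul0mx mxE eqxx.
  by rewrite in_setI (mem_zeros hM v0) (mem_zeros hN v0) !qform_eval.
by rewrite cardsU1 inE eqxx /= addnC leq_add2l; exact: card_points.
Qed.

(** The two linear forms b(-, u) and b(-, w) of a hyperbolic pair (u, w) are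
    separated by the point u, a zero of the first but not of the second. *)
Lemma polar_hyperplanes (M : 'M[F]_n.+1) (p : V * V) :
  hyperbolic_pair M p ->
  exists a1 a2 : V,
    [/\ hyperplane (zeros (lform a1)), hyperplane (zeros (lform a2)),
        zeros (lform a1) != zeros (lform a2),
        forall x : V, (lform a1).@[x 0] = bilin (polar M) x p.1
      & forall x : V, (lform a2).@[x 0] = bilin (polar M) x p.2].
Proof.
move=> hp; have [e11 e12 e21 e22] := pair_values hp.
pose a (v : V) := (polar M *m v^T)^T.
have ev v (x : V) : (lform (a v)).@[x 0] = bilin (polar M) x v.
  by rewrite lform_eval /a trmxK mulmxA.
have n0 v w : bilin (polar M) w v != 0 -> hyperplane (zeros (lform (a v))).
  move=> wv; exists (lform (a v)); split=> //; last exact: lform_homog.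
  by apply: contra_neq wv => e; rewrite -ev e meval0.
exists (a p.1), (a p.2); split=> //.
- by apply: (n0 _ p.2); rewrite e21 oner_eq0.
- by apply: (n0 _ p.1); rewrite e12 oner_eq0.
have p10 : p.1 != 0.
  by apply: contra_eq_neq e12 => ->; rewrite /bilin !mul0mx mxE eq_sym oner_eq0.
apply/eqP => /setP/(_ (proj_point p.1)).
by rewrite !(mem_zeros (lform_homog _) p10) !ev e11 e12 eqxx oner_eq0.
Qed.

End Points.

(** * The pencil spanned by two quadratic forms *)

(** Each pair split off lowers the excess of the number of zeros over q^5 by a
    factor q. *)
Lemma dim6_count (F : finFieldType) (M : 'M[F]_6) (q := #|F|) :
  (nzeros M setT <= q ^ 5 + q.-1 * q ^ 2)%N \/
  exists s : seq ('rV[F]_6 * 'rV[F]_6),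
    [/\ (size s <= 2)%N,
        {in s, forall p, hyperbolic_pair M p},
        forall x, quad M x = polar_sum M s x
      & size s = 2 -> (nzeros M setT <= q ^ 5 + q.-1 * q ^ 3)%N].
Proof.
have q1 : (1 < q)%N := card_finNzRing_gt1 F.
have cV : #|[set: 'rV[F]_6]| = (q ^ 6)%N by rewrite cardsT card_mx mul1n.
have [|few|[s [hs fs ns]]] := @witt_count F 6 M setT.
- by move=> *; rewrite inE.
-  left; move: few; rewrite cV -/q (expnS q 5) leq_pmul2l ?(ltnW q1) // => few.
  by apply: leq_trans few (leq_addr _ _).
(* For k.+2 > 5 the truncated exponent is 0, and the bound still follows from
   the equation ns. *)
have bound k : size s = k.+2 ->
    (nzeros M setT <= q ^ 5 + q.-1 * q ^ (5 - k.+2))%N.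
  move=> sk; have qn m : (0 < q ^ m)%N by rewrite expn_gt0 ltnW.
  rewrite -(leq_pmul2l (qn (size s).+1)) ns cV sk !mulnDr.
  have -> : (q ^ 6 * q ^ k.+2 = q ^ k.+3 * q ^ 5)%N.
    by rewrite -!expnD; congr expn; lia.
  rewrite leq_add2l (mulnC (q ^ 6)%N) (mulnCA (q ^ k.+3)%N) -expnD leq_mul2l.
  by rewrite leq_exp2l //; apply/orP; right; lia.
have [s2|s2] := leqP (size s) 2; [right|left].
  exists s; split=> // [p /hs[]//|x|/bound//]; exact: fs.
case: (size s) s2 bound => [|[|[|k]]] // _ /(_ _ erefl)/leq_trans-> //.
rewrite leq_add2l leq_mul2l leq_exp2l //; apply/orP; right; lia.
Qed.

(** At a vector x with f x = 0, all or none of the q members g - t f vanish,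
    according to g x; otherwise exactly the member with t = g x / f x does. *)
Lemma pencil_count (F : finFieldType) n (M N : 'M[F]_n) :
  (\sum_t nzeros (N - t *: M) setT + nzeros M setT =
   #|F| * #|[set x | (quad M x == 0%R) && (quad N x == 0%R)]| + #|F| ^ n)%N.
Proof.
have nzT K : nzeros K setT = (\sum_x (quad K x == 0%R))%N.
  by apply: eq_bigl => x; rewrite inE.
under eq_bigr => t _ do rewrite nzT.
have -> : (#|F| ^ n = \sum_(x : 'rV[F]_n) 1)%N.
  by rewrite sum1_card card_mx mul1n.
rewrite nzT exchange_big -sum1dep_card big_distrr [in RHS]big_mkcond /=.
rewrite -!big_split /=; apply: eq_bigr => x _.
have ev t : quad (N - t *: M) x = quad N x - t * quad M x.
  by rewrite /quad -scaleNr bilinDm bilinZm mulNr.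
under eq_bigr => t _ do rewrite ev.
have [f0|f0] := eqVneq (quad M x) 0 => /=.
  rewrite f0; under eq_bigr => t _ do rewrite mulr0 subr0.
  by rewrite sum_nat_const; case: eqP => _; rewrite ?muln1 ?muln0.
rewrite addn0 add0n (bigD1 (quad N x / quad M x)) //= divfK // subrr eqxx.
rewrite big1 // => t; apply: contraNeq; rewrite eqb0 negbK subr_eq0 => /eqP ->.
by rewrite mulfK.
Qed.

(** Summing the bounds over the q + 1 members, at most three of them with the
    exponent 3, gives q^3 + 5 q^2 - q + 1. *)
Lemma pencil_bound (F : finFieldType) (M N : 'M[F]_6) (E : {set F})
    (q := #|F|) :
    qform M \is 2.-homog -> qform N \is 2.-homog -> (#|E| <= 3)%N ->
    (nzeros M setT <= q ^ 5 + q.-1 * q ^ 2)%N ->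
    (forall t, nzeros (N - t *: M) setT <=
               q ^ 5 + q.-1 * q ^ (2 + (t \in E)))%N ->
  (#|zeros (qform M) :&: zeros (qform N)| <= q ^ 3 + 5 * q ^ 2 + 1)%N.
Proof.
move=> hM hN cE NM small; have q1 : (1 < q)%N := card_finNzRing_gt1 F.
set B := (q ^ 5 + q.-1 * q ^ 2)%N in NM.
(* The difference between the bounds with the exponents 3 and 2. *)
set D := (q.-1 * (q.-1 * q ^ 2))%N.
have BD t : (q ^ 5 + q.-1 * q ^ (2 + (t \in E)) = B + (t \in E) * D)%N.
  case: (t \in E); rewrite ?mul0n ?addn0 // mul1n /B /D -addnA -mulnDr -mulSn.
  by rewrite prednK ?(ltnW q1) // -expnS addn1.
have points := card_common_zeros hM hN; have := pencil_count M N.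
move: points; set Vh := [set x | _] => points count.
have sum_le : (\sum_t nzeros (N - t *: M) setT <= q * B + #|E| * D)%N.
  apply: (@leq_trans (\sum_t (B + (t \in E) * D))).
    by apply: leq_sum => t _; rewrite -BD.
  rewrite big_split /= sum_nat_const -big_distrl /= leq_add2l leq_mul2r.
  by apply/orP; right; rewrite -big_mkcond sum1_card.
have {sum_le} : (q * #|Vh| + q ^ 6 <= q * B + 3 * D + B)%N.
  rewrite -count leq_add // (leq_trans sum_le) // leq_add2l leq_mul2r.
  by rewrite cE orbT.
move: points; rewrite /B /D {count NM small BD B D} -/q.
move: q q1 #|Vh| #|_| => [|[|k]] // _ h v.
rewrite !expnS expn0 /= => points sum_le; rewrite leqNgt; apply/negP => lt_v.
have : (k.+2 * (k.+1 * (k.+2 * (k.+2 * (k.+2 * 1)) + 5 * (k.+2 * (k.+2 * 1))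
                        + 1).+1 + 1) <= k.+2 * h)%N.
  rewrite leq_mul2l /=; apply: leq_trans points; rewrite leq_add2r.
  by rewrite leq_mul2l.
move: sum_le; clear; nia.
Qed.

(** * The equation of a hyperbolic quadric *)

Lemma lin_subst_klein (F : finFieldType) (A : 'M[F]_6) :
  let L i := lform (row (inord i) A) in
  lin_subst A (klein_form F) = L 0%N * L 1%N + L 2%N * L 3%N + L 4%N * L 5%N.
Proof.
move=> L; rewrite /lin_subst /klein_form !rmorphD !rmorphM /= !comp_mpolyXU.
have nthL i :
    [tuple \sum_(j < 6) A i j *: 'X_j | i < 6]`_(inord i : 'I_6) = L i.
  by rewrite nth_mktuple; apply: eq_bigr => j _; rewrite mxE.
by rewrite !nthL.
Qed.

Lemma hyperbolic_homog (F : finFieldType) (Q : {mpoly F[6]}) :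
  hyperbolic_quadric Q -> Q \is 2.-homog.
Proof.
case=> A _ [c _ ->]; rewrite lin_subst_klein; apply: rpredZ.
by rewrite !rpredD // (dhomogM (lform_homog _) (lform_homog _)).
Qed.

(** In the coordinates l_i = (x A^T)_i the polar form is, up to the factor c,
    the sum of the l_i(x) l_j(y) over ordered pairs of partners i, j among
    {0, 1}, {2, 3}, {4, 5}.  A vector in its radical has all its coordinates
    zero, as is seen by pairing it with the vectors y of the dual basis. *)
Lemma klein_nondegenerate (F : finFieldType) (Q : {mpoly F[6]}) (M : 'M[F]_6) :
  hyperbolic_quadric Q -> Q = qform M -> polar M \in unitmx.
Proof.
case=> A uA [c c0 ->]; rewrite lin_subst_klein => eM.
have eval_row i (x : 'rV[F]_6) :
    (lform (row (inord i) A)).@[x 0] = (x *m A^T) 0 (inord i).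
  by rewrite lform_eval !mxE; apply: eq_bigr => j _; rewrite !mxE.
pose l i (x : 'rV[F]_6) := (x *m A^T) 0 (inord i : 'I_6).
have quadE x : quad M x =
    c * (l 0%N x * l 1%N x + l 2%N x * l 3%N x + l 4%N x * l 5%N x).
  by rewrite -qform_eval -eM mevalZ !mevalD !mevalM !eval_row.
have lD i x y : l i (x + y) = l i x + l i y by rewrite /l mulmxDl mxE.
have polE x y : bilin (polar M) x y =
    c * (l 0%N x * l 1%N y + l 1%N x * l 0%N y
         + l 2%N x * l 3%N y + l 3%N x * l 2%N y
         + l 4%N x * l 5%N y + l 5%N x * l 4%N y).
  have -> : bilin (polar M) x y = quad M (x + y) - (quad M x + quad M y).
    by rewrite quadD addrC addKr.
  by rewrite !quadE !lD; ring.
rewrite -row_free_unit -kermx_eq0; apply/eqP/row_matrixP => r; rewrite row0.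
set v := row r _; have vS : v *m polar M = 0.
  by apply/sub_kermxP; rewrite row_sub.
suff u0 : v *m A^T = 0.
  by rewrite -[LHS](@mulmxK _ _ _ A^T) ?unitmx_tr // u0 mul0mx.
have pair0 (k : nat) : (k < 6)%N ->
  let d m := ((m == k)%:R : F) in
  l 0%N v * d 1%N + l 1%N v * d 0%N + l 2%N v * d 3%N + l 3%N v * d 2%N
  + l 4%N v * d 5%N + l 5%N v * d 4%N = 0.
  move=> k6 d; pose y : 'rV[F]_6 := delta_mx 0 (inord k : 'I_6) *m invmx A^T.
  have ly m : (m < 6)%N -> l m y = d m.
    move=> m6; rewrite /l mulmxKV ?unitmx_tr // mxE eqxx /=.
    by rewrite -val_eqE /= !inordK.
  have := polE v y; rewrite /bilin vS mul0mx mxE => /esym/eqP.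
  by rewrite mulf_eq0 (negPf c0) /= !ly // => /eqP.
apply/rowP => j; rewrite [RHS]mxE -[j]inord_val -/(l j v).
case: j => j /= j6.
(* The index is the partner of j. *)
have := pair0 (if odd j then j.-1 else j.+1).
by case: j j6 => [|[|[|[|[|[|]]]]]] //= _ /(_ isT);
  rewrite ?mulr0 ?mulr1 ?addr0 ?add0r.
Qed.

Theorem corollary2p6 (q : nat) (F : finFieldType) (card_F : #|F| = q)
  (Q Q' : {mpoly F[6]}) (hypQ : hyperbolic_quadric Q) (quadQ' : quadric Q')
  (distinct : ~ proportional Q Q')
  (large : (q ^ 3 + 5 * q ^ 2 + 1 < #|zeros Q :&: zeros Q'|)%N) :
  exists H1 H2 : {set {set 'rV[F]_6}},
    [/\ hyperplane H1, hyperplane H2, H1 != H2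
      & zeros Q :&: zeros Q' = zeros Q :&: (H1 :|: H2)].
Proof.
rewrite -card_F in large *; have q1 := card_finNzRing_gt1 F.
have hQ := hyperbolic_homog hypQ; have [Q'0 hQ'] := quadQ'.
have [M uM eM] := homog2_qform hQ; have [M' uM' eM'] := homog2_qform hQ'.
have unitM := klein_nondegenerate hypQ eM.
pose E := [set t | (\rank (polar M' - t *: polar M)%R + 2 <= 6)%N].
have cE : (#|E| <= 3)%N.
  by rewrite -(leq_pmul2l (isT : 0 < 2)%N); exact: pencil_rank.
have polarE t : polar (M' - t *: M) = polar M' - t *: polar M.
  by apply/matrixP=> i j; rewrite !mxE; ring.
have NM : (nzeros M setT <= #|F| ^ 5 + #|F|.-1 * #|F| ^ 2)%N.
  have [//|[s [s2 _ /rank_sum_products rk _]]] := dim6_count M.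
  by move: rk; rewrite mxrank_unit //; case: s s2 => [|? [|? []]].
have [t lt_t] : exists t,
    (#|F| ^ 5 + #|F|.-1 * #|F| ^ (2 + (t \in E)) < nzeros (M' - t *: M) setT)%N.
  apply/existsP; apply: contraLR large; rewrite negb_exists => /forallP small.
  rewrite -leqNgt eM eM'; apply: pencil_bound cE NM _; rewrite -?eM -?eM' //.
  by move=> t; rewrite leqNgt.
have [le|[s [s2 hs fs bs]]] := dim6_count (M' - t *: M).
  have := leq_trans lt_t le; rewrite ltn_add2l ltn_mul2l ltn_exp2l //.
  by case: (t \in E); rewrite andbF.
have tE : t \in E.
  rewrite inE -polarE (leq_add2r 2 _ 4).
  by apply: leq_trans (rank_sum_products fs) _; rewrite (leq_mul2l 2 _ 2).
have ev (x : 'rV[F]_6) : Q'.@[x 0] = t * Q.@[x 0] + quad (M' - t *: M) x.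
  by rewrite eM eM' !qform_eval /quad -scaleNr bilinDm bilinZm; ring.
case: s s2 hs fs bs => [|p [|p' [|//]]] _ hs fs bs.
- have Mt : M' = t *: M.
    apply/eqP; rewrite -subr_eq0; apply/eqP/upper_quad0 => [i j ji|x].
      by rewrite !mxE uM // uM' // mulr0 subr0.
    by rewrite fs /polar_sum big_nil.
  case: distinct; exists t; last by rewrite eM' eM Mt qformZ.
  by apply: contraNneq Q'0 => t0; rewrite eM' Mt t0 scale0r qform0.
- have [a1 [a2 [h1 h2 h12 e1 e2]]] := polar_hyperplanes (hs p (mem_head _ _)).
  exists (zeros (lform a1)), (zeros (lform a2)); split=> //.
  apply/setP=> x; rewrite inE [in RHS]inE [x \in _ :|: _]inE.
  case Qx : (x \in zeros Q) => //=.
  have : x \in PG 5 F by move: Qx; rewrite inE => /andP[].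
  case/imsetP=> v; rewrite inE => v0 ex; rewrite ex in Qx *.
  move: Qx; rewrite (mem_zeros hQ v0) => /eqP Qv.
  rewrite (mem_zeros hQ' v0) !(mem_zeros (lform_homog _) v0) ev Qv e1 e2.
  by rewrite fs /polar_sum big_seq1 mulr0 add0r mulf_eq0.
by have := leq_trans lt_t (bs erefl); rewrite tE ltnn.
Qed.
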